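(* Let $\mathcal{X}_N=\{\mathbf{x}_1,\dots,\mathbf{x}_N\}$ be an $\varepsilon_0$-net of $\mathcal{X}$ and let the base points $\mathcal{B}_m=\{\mathbf{b}_1,\dots,\mathbf{b}_m\}$ be sampled independently according to a probability measure $\mu$ on $\mathcal{X}$ with $$m\geq\frac{1}{2\delta^2}\left(\#(\mathscr{M})\ln2-\ln p\right),\qquad p,\delta\in(0,1).$$ Let $\gamma>0$ and $\varepsilon>0$, and suppose that $\mathbf{g}$ and the measurement functions $\mathbf{m}_k$, $k\in\mathscr{M}$, are all Lipschitz over $\mathcal{X}$. Then, with probability at least $1-p$ over the base points, the following holds. Suppose that every $\mathbf{b}_i\in\mathcal{B}_m$ and $\mathbf{x}_j\in\mathcal{X}_N$ satisfy $$\Vert\mathbf{g}(\mathbf{b}_i)-\mathbf{g}(\mathbf{x}_j)\Vert_2\geq\varepsilon\ \Rightarrow\ \Vert\mathbf{m}_{\mathscr{M}}(\mathbf{b}_i)-\mathbf{m}_{\mathscr{M}}(\mathbf{x}_j)\Vert_2\geq\gamma.$$ If $\mathscr{S}\subseteq\mathscr{M}$ (possibly chosen depending on the base points) satisfies $f_{\gamma,\varepsilon,m}(\mathscr{S})=f_{\gamma,\varepsilon,m}(\mathscr{M})$, then the $\mu$-measure of the set of points $\mathbf{x}\in\mathcal{X}$ such that, for every $\mathbf{x}'\in\mathcal{X}$, $$\Vert\mathbf{g}(\mathbf{x})-\mathbf{g}(\mathbf{x}')\Vert_2\geq\varepsilon+\varepsilon_0\Vert\mathbf{g}\Vert_{\mathrm{lip}}\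 \Rightarrow\ \Vert\mathbf{m}_{\mathscr{S}}(\mathbf{x})-\mathbf{m}_{\mathscr{S}}(\mathbf{x}')\Vert_2>\gamma-\varepsilon_0\Vert\mathbf{m}_{\mathscr{S}}\Vert_{\mathrm{lip}}$$ is at least $1-\delta$.
   Context: $\mathcal{X}\subset\mathbb{R}^n$; $\mathscr{M}$ is a finite set of sensors; $\mathbf{g}:\mathcal{X}\to\mathbb{R}^q$ is the target function and $\mathbf{m}_j:\mathcal{X}\to\mathbb{R}^{d_j}$, $j\in\mathscr{M}$, are the measurement functions. $\#(\cdot)$ denotes cardinality. For $\mathscr{S}\subseteq\mathscr{M}$, $\mathbf{m}_{\mathscr{S}}=(\mathbf{m}_j)_{j\in\mathscr{S}}$ is the concatenated measurement. An $\varepsilon_0$-net of $\mathcal{X}$ is a finite subset $\mathcal{X}_N\subset\mathcal{X}$ such that for every $\mathbf{x}\in\mathcal{X}$ there is $\mathbf{x}_i\in\mathcal{X}_N$ with $\Vert\mathbf{x}-\mathbf{x}_i\Vert_2<\varepsilon_0$. $\Vert\cdot\Vert_{\mathrm{lip}}$ denotes the Lipschitz constant over $\mathcal{X}$ with respect to Euclidean norms. The sampled objective is $$f_{\gamma,\varepsilon,m}(\mathscr{S})=\frac{1}{mN}\sum_{\substack{1\leq i\leq m,\ 1\leq j\leq N:\\ \Vert\mathbf{g}(\mathbf{b}_i)-\mathbf{g}(\mathbf{x}_j)\Vert_2\geq\varepsilon}}w_{\gamma,\mathbf{b}_i,\mathbf{x}_j}(\mathscr{S})\Vert\mathbf{g}(\mathbf{b}_i)-\mathbf{g}(\mathbf{x}_j)\Vert_2^2,$$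 $$w_{\gamma,\mathbf{x},\mathbf{x}'}(\mathscr{S})=\min\left\{\tfrac{1}{\gamma^2}\Vert\mathbf{m}_{\mathscr{S}}(\mathbf{x})-\mathbf{m}_{\mathscr{S}}(\mathbf{x}')\Vert_2^2,\ 1\right\}.$$ *)

(* Defs.v *)
From HB Require Import structures.
From mathcomp Require Import all_boot all_order all_algebra.
From mathcomp Require Import all_classical all_reals all_analysis.

Set Implicit Arguments.
Unset Strict Implicit.
Unset Printing Implicit Defensive.

Import Order.TTheory GRing.Theory Num.Theory.
Import numFieldNormedType.Exports.
Local Open Scope classical_set_scope.
Local Open Scope ring_scope.

(* The library norm on row vectors is the sup norm, hence this definition. *)
Definition norm2 (R : realType) (k : nat) (v : 'rV[R]_k) : R :=
  Num.sqrt (\sum_(i < k) v ord0 i ^+ 2).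

(* The subset X as a subspace of R^n.  Measurable types are pointed in the
   library, so the nonemptiness proof is carried in the type. *)
Definition domain (R : realType) (n : nat) (X : set 'rV[R]_n)
  (X0 : X !=set0) : Type := X.

Section domain_instances.
Context (R : realType) (n : nat) (X : set 'rV[R]_n) (X0 : X !=set0).

HB.instance Definition _ := Topological.copy (domain X0) (X : Type).
HB.instance Definition _ := isPointed.Build (domain X0)
  (exist _ (proj1_sig (cid X0)) (mem_set (proj2_sig (cid X0)))).

End domain_instances.

(* Borel sigma-algebra of the subspace topology; X itself need not be a Borel
   subset of R^n. *)
Definition borel (R : realType) (n : nat) (X : set 'rV[R]_n)
  (X0 : X !=set0) := g_sigma_algebraType (@open (domain X0)).

Section euclidean_subsets.
Context (R : realType) (n : nat) (X : set 'rV[R]_n).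

Definition is_net (e0 : R) (E : set X) : Prop :=
  finite_set E /\
  forall x : X, exists2 y : X, E y & norm2 (\val x - \val y) < e0.

Definition lip_bound (k : nat) (f : X -> 'rV[R]_k) (L : R) : Prop :=
  0 <= L /\
  forall x y : X, norm2 (f x - f y) <= L * norm2 (\val x - \val y).

Definition is_lipschitz (k : nat) (f : X -> 'rV[R]_k) : Prop :=
  exists L : R, lip_bound f L.

(* Meaningful when f is Lipschitz. *)
Definition lip_const (k : nat) (f : X -> 'rV[R]_k) : R :=
  inf [set L : R | lip_bound f L].

(* Blocks in the order of the enumeration of S, an element of
   R^(\sum_(j in S) d j). *)
Definition concat (M : finType) (d : M -> nat)
    (ms : forall j : M, X -> 'rV[R]_(d j)) (S : {set M}) (x : X) :
    'rV[R]_(\sum_(k < #|S|) d (enum_val k)) :=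
  \mxrow_(k < #|S|) ms (enum_val k) x.

Definition weight (M : finType) (d : M -> nat)
    (ms : forall j : M, X -> 'rV[R]_(d j)) (gamma : R) (x x' : X)
    (S : {set M}) : R :=
  Num.min ((gamma ^+ 2)^-1 * norm2 (concat ms S x - concat ms S x') ^+ 2) 1.

Definition sampled_objective (q : nat) (g : X -> 'rV[R]_q)
    (M : finType) (d : M -> nat) (ms : forall j : M, X -> 'rV[R]_(d j))
    (gamma eps : R) (m N : nat) (b : 'I_m -> X) (xs : 'I_N -> X)
    (S : {set M}) : R :=
  ((m * N)%:R)^-1 *
  \sum_(i < m) \sum_(j < N | eps <= norm2 (g (b i) - g (xs j)))
     weight ms gamma (b i) (xs j) S * norm2 (g (b i) - g (xs j)) ^+ 2.

End euclidean_subsets.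

Section probability_notions.
Context (R : realType).

(* "A has measure at least c" without assuming A measurable: some measurable
   subset of A has measure at least c.  It is equivalent to c%:E <= mu A when
   A is measurable.  Needed because sets cut out by a quantifier over all the
   points of X need not be Borel. *)
Definition measure_at_least (d : measure_display) (T : measurableType d)
    (mu : probability T R) (A : set T) (c : R) : Prop :=
  exists B : set T, [/\ measurable B, B `<=` A & (c%:E <= mu B)%E].

Definition mutually_independent (d d' : measure_display)
    (Omega : measurableType d) (T : measurableType d')
    (P : probability Omega R) (m : nat) (b : 'I_m -> {RV P >-> T}) : Prop :=
  forall (J : {set 'I_m}) (A : 'I_m -> set T),
    (forall i : 'I_m, i \in J -> measurable (A i)) ->
    P (\bigcap_(i in [set i : 'I_m | i \in J]) (b i @^-1` A i)) =
      (\prod_(i in J) P (b i @^-1` A i))%E.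

Definition iid_sample (d d' : measure_display)
    (Omega : measurableType d) (T : measurableType d')
    (P : probability Omega R) (mu : probability T R)
    (m : nat) (b : 'I_m -> {RV P >-> T}) : Prop :=
  (forall (i : 'I_m) (A : set T), measurable A ->
     distribution P (b i) A = mu A) /\
  mutually_independent b.

End probability_notions.

(* Main.v *)
Require Import Defs.
From mathcomp Require Import all_boot all_order all_algebra.
From mathcomp Require Import all_classical all_reals all_analysis.
From mathcomp Require Import ring.

Set Implicit Arguments.
Unset Strict Implicit.
Unset Printing Implicit Defensive.

Import Order.TTheory GRing.Theory Num.Theory.
Import numFieldNormedType.Exports.
Local Open Scope classical_set_scope.
Local Open Scope ring_scope.

(** Call a point [x] resolved by a sensor set [S] if, for every net point [x_j],
    [g x] and [g x_j] being [eps]-far apart forces the concatenated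
    measurements of [S] at [x] and [x_j] to be [gamma]-far apart.

    Resolved points have the wanted separation property against all of [X]
    ([resolved_separates]): replacing [x'] by a net point within [e0] changes
    the target by at most [e0 * lip_const g] and the measurement by at most
    [e0] times its Lipschitz constant.  So it suffices that the set [G S] of
    points resolved by [S] has measure at least [1 - delta].

    When the full sensor set resolves every base point, all its weights on
    [eps]-far pairs equal 1, the largest possible value; equality of the two
    objectives then forces the weights of [S] to be 1 as well, that is, [S]
    also resolves every base point ([resolved_sample]).

    The sampling enters only through the following event: some [S] with
    [mu (G S) < 1 - delta] resolves all [m] base points.  For a fixed [S] its
    probability is [mu (G S) ^ m <= (1 - delta) ^ m] by independence, and a
    union bound over the [2 ^ #|M|] sensor sets makes the choice of [S] after
    the sampling harmless ([prob_covering_sets_large]).  The sample size is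
    Hoeffding's, [1 - delta <= exp (- 2 delta ^ 2)] being the tail bound for
    [m] successes in [m] trials ([onem_le_expR_sqr], [union_bound_le]).

    The sets [G S] are Borel because only finitely many net points occur in
    their definition and Lipschitz maps are continuous
    ([measurable_resolved]); this is why they, and not the sets in the
    conclusion, are the ones to which probability is applied. *)

(** * The Euclidean norm on row vectors *)

Section norm2_theory.
Context (R : realType) (k : nat).
Implicit Types (u v : 'rV[R]_k).

Lemma norm2_ge0 v : 0 <= norm2 v.
Proof. exact: sqrtr_ge0. Qed.

Lemma norm2_sqr v : norm2 v ^+ 2 = \sum_(i < k) v ord0 i ^+ 2.
Proof. by rewrite sqr_sqrtr// sumr_ge0// => i _; exact: sqr_ge0. Qed.

Lemma norm2_0 : norm2 (0 : 'rV[R]_k) = 0.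
Proof. by rewrite /norm2 big1 ?sqrtr0// => i _; rewrite mxE expr0n. Qed.

Lemma norm2_distC u v : norm2 (u - v) = norm2 (v - u).
Proof.
by congr Num.sqrt; apply: eq_bigr => i _; rewrite !mxE -opprB sqrrN.
Qed.

Lemma entry_le_norm2 v i : `|v ord0 i| <= norm2 v.
Proof.
rewrite -(ler_pXn2r (_ : 0 < 2)%N) ?nnegrE ?norm2_ge0// norm2_sqr.
rewrite real_normK ?num_real//.
by rewrite (bigD1 i)//= lerDl sumr_ge0// => j _; exact: sqr_ge0.
Qed.

(** A crude comparison with the sup norm, with [k] instead of its square root:
    enough for continuity and for the mere existence of Lipschitz bounds. *)
Lemma norm2_le_entries v (C : R) : 0 <= C ->
  (forall i, `|v ord0 i| <= C) -> norm2 v <= k%:R * C.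
Proof.
move=> C0 vC.
rewrite -(ler_pXn2r (_ : 0 < 2)%N) ?nnegrE ?norm2_ge0 ?mulr_ge0//.
rewrite norm2_sqr (@le_trans _ _ (\sum_(i < k) C ^+ 2))//.
  by apply: ler_sum => i _; rewrite -real_normK ?num_real// lerXn2r ?nnegrE.
rewrite sumr_const card_ord exprMn -(mulr_natl (C ^+ 2)) ler_wpM2r ?sqr_ge0//.
by rewrite -natrX ler_nat; case: (k) => // k'; rewrite leq_pmulr.
Qed.

(** Entrywise, with [a] and [b] the two norms, Young's inequality
    [2 x y <= (b / a) x ^ 2 + (a / b) y ^ 2] sums to the Cauchy-Schwarz bound
    [2 a b] for the cross terms. *)
Lemma norm2D u v : norm2 (u + v) <= norm2 u + norm2 v.
Proof.
have [u0|u0] := eqVneq (norm2 u) 0.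
  suff -> : u = 0 by rewrite add0r norm2_0 add0r.
  apply/rowP => i; rewrite mxE; apply/eqP; rewrite -normr_le0.
  by rewrite -u0 entry_le_norm2.
have [v0|v0] := eqVneq (norm2 v) 0.
  suff -> : v = 0 by rewrite addr0 norm2_0 addr0.
  apply/rowP => i; rewrite mxE; apply/eqP; rewrite -normr_le0.
  by rewrite -v0 entry_le_norm2.
have {}u0 : 0 < norm2 u by rewrite lt_neqAle eq_sym u0 norm2_ge0.
have {}v0 : 0 < norm2 v by rewrite lt_neqAle eq_sym v0 norm2_ge0.
rewrite -(ler_pXn2r (_ : 0 < 2)%N) ?nnegrE ?addr_ge0 ?norm2_ge0// norm2_sqr.
set a := norm2 u in u0 *; set b := norm2 v in v0 *.
apply: (@le_trans _ _ (\sum_(i < k)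
    ((1 + b / a) * u ord0 i ^+ 2 + (1 + a / b) * v ord0 i ^+ 2))).
  apply: ler_sum => i _; rewrite mxE -subr_ge0.
  set x := u _ _; set y := v _ _.
  have -> : (1 + b / a) * x ^+ 2 + (1 + a / b) * y ^+ 2 - (x + y) ^+ 2
      = (b * x - a * y) ^+ 2 / (a * b) by field; rewrite !gt_eqF.
  by rewrite divr_ge0 ?sqr_ge0 ?mulr_ge0 ?ltW.
rewrite big_split/= -!mulr_sumr -!norm2_sqr -/a -/b le_eqVlt; apply/orP; left.
by apply/eqP; field; rewrite !gt_eqF.
Qed.

Lemma norm2_dist_triangle u v w : 
  norm2 (u - w) <= norm2 (u - v) + norm2 (v - w).
Proof. by rewrite (le_trans _ (norm2D _ _))// addrA subrK. Qed.

End norm2_theory.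

(** * Lipschitz constants *)

Section lipschitz.
Context (R : realType) (n : nat) (X : set 'rV[R]_n).

(** For each pair of points the Lipschitz inequality is a closed condition on
    the bound, so it passes to the infimum of all bounds. *)
Lemma lip_constP (k : nat) (f : X -> 'rV[R]_k) :
  is_lipschitz f -> lip_bound f (lip_const f).
Proof.
move=> [L fL]; split; first by apply: lb_le_inf; [exists L|move=> ? []].
move=> x y; have [D0|D0] := ltP 0 (norm2 (\val x - \val y)); last first.
  have D : norm2 (\val x - \val y) = 0 by apply/eqP; rewrite eq_le D0 norm2_ge0.
  by have := fL.2 x y; rewrite D !mulr0.
rewrite -ler_pdivrMr//; apply: lb_le_inf; first by exists L.
by move=> L' [_ /(_ x y)]; rewrite ler_pdivrMr.
Qed.

(** Each entry of the concatenation is an entry of one of the [ms j], hence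
    varies no faster than the sum of all their Lipschitz constants allows. *)
Lemma lipschitz_concat (M : finType) (d : M -> nat)
    (ms : forall j : M, X -> 'rV[R]_(d j)) (S : {set M}) :
  (forall j, is_lipschitz (ms j)) -> is_lipschitz (concat ms S).
Proof.
move=> hms; pose L := \sum_j lip_const (ms j).
have L0 j : 0 <= lip_const (ms j) by have [] := lip_constP (hms j).
exists ((\sum_(k < #|S|) d (enum_val k))%:R * L).
split=> [|x y]; first by rewrite mulr_ge0// sumr_ge0.
rewrite -mulrA; apply: norm2_le_entries => [|i].
  by rewrite mulr_ge0 ?norm2_ge0// sumr_ge0.
rewrite !mxE; set j := enum_val _.
have -> (a b : 'rV[R]_(d j)) l : a ord0 l - b ord0 l = (a - b) ord0 l.
  by rewrite !mxE.
apply: (le_trans (entry_le_norm2 _ _)).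
apply: (le_trans ((lip_constP (hms j)).2 x y)).
by rewrite ler_wpM2r ?norm2_ge0// /L (bigD1 j)//= lerDl sumr_ge0.
Qed.

End lipschitz.

(** * Borel sets defined by Lipschitz maps *)

Section borel_sets.
Context (R : realType) (n : nat) (X : set 'rV[R]_n) (X0 : X !=set0).

Lemma open_norm2_lt (k : nat) (f : X -> 'rV[R]_k) (y : X) (c : R) :
  is_lipschitz f -> open [set x : domain X0 | norm2 (f x - f y) < c].
Proof.
move=> fl; have [L0 fL] := lip_constP fl; set L := lip_const f in L0 fL.
rewrite openE => x /= xc; set r := c - norm2 (f x - f y).
have r0 : 0 < r by rewrite subr_gt0.
have K0 : 0 < L * n%:R + 1 by rewrite ltr_wpDl// mulr_ge0.
have e0 : 0 < r / (L * n%:R + 1) by rewrite divr_gt0.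
have := @initial_continuous _ _ (\val : X -> _) x _ (nbhsx_ballx _ _ e0).
apply: (@filterS (domain X0) (nbhs (x : domain X0))) => z /= [_ xz].
apply: (le_lt_trans (norm2_dist_triangle _ (f x) _)).
rewrite -ltrBrDr -/r norm2_distC (le_lt_trans (fL _ _))//.
have : norm2 (\val x - \val z) <= n%:R * (r / (L * n%:R + 1)).
  apply: norm2_le_entries => [|i]; first exact: ltW.
  by rewrite !mxE; exact/ltW/xz.
move=> /(ler_wpM2l L0) /le_lt_trans; apply.
by rewrite (mulrA L) mulrCA gtr_pMr// ltr_pdivrMr// mul1r ltrDl.
Qed.

Lemma measurable_norm2_lt (k : nat) (f : X -> 'rV[R]_k) (y : X) (c : R) :
  is_lipschitz f -> measurable [set x : borel X0 | norm2 (f x - f y) < c].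
Proof. by move=> fl; apply: sub_sigma_algebra; exact: open_norm2_lt. Qed.

End borel_sets.

(** * Points resolved by the net *)

Section resolved.
Context (R : realType) (n : nat) (X : set 'rV[R]_n).

(** The comparison is with the finitely many net points only, which makes this
    set Borel. *)
Definition resolved (q k : nat) (g : X -> 'rV[R]_q) (h : X -> 'rV[R]_k)
    (gamma eps : R) (N : nat) (xs : 'I_N -> X) : set X :=
  [set x | forall j, eps <= norm2 (g x - g (xs j)) ->
                     gamma <= norm2 (h x - h (xs j))].

(** A finite intersection, over the net, of unions of an open and a closed
    set. *)
Lemma measurable_resolved (X0 : X !=set0) (q k : nat)
    (g : X -> 'rV[R]_q) (h : X -> 'rV[R]_k) (gamma eps : R)
    (N : nat) (xs : 'I_N -> X) : is_lipschitz g -> is_lipschitz h ->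
  measurable (resolved g h gamma eps xs : set (borel X0)).
Proof.
move=> gl hl.
rewrite (_ : resolved _ _ _ _ _ = \bigcap_(j in [set: 'I_N])
  ([set x : borel X0 | norm2 (g x - g (xs j)) < eps] `|`
   ~` [set x : borel X0 | norm2 (h x - h (xs j)) < gamma])).
  apply: fin_bigcap_measurable => // j _.
  by apply: measurableU; [|apply: measurableC]; exact: measurable_norm2_lt.
apply/seteqP; split => [x xr j _|x xr j ge] /=.
  have [?|/xr ?] := ltP (norm2 (g x - g (xs j))) eps; first by left.
  by right; apply/negP; rewrite -leNgt.
by have [/=|/= /negP] := xr j Logic.I; [rewrite ltNge ge|rewrite -leNgt].
Qed.

(** Two triangle inequalities through a net point near [x'].  The strict
    inequality comes from the strict one in the definition of a net, as long
    as [h] has a positive Lipschitz constant. *)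
Lemma resolved_separates (q k : nat) (g : X -> 'rV[R]_q) (h : X -> 'rV[R]_k)
    (gamma eps e0 : R) (N : nat) (xs : 'I_N -> X) (x x' : X) :
  is_net e0 (range xs) -> 0 < gamma -> is_lipschitz g -> is_lipschitz h ->
  resolved g h gamma eps xs x ->
  eps + e0 * lip_const g <= norm2 (g x - g x') ->
  gamma - e0 * lip_const h < norm2 (h x - h x').
Proof.
move=> [_ /(_ x')[_ [j _ <-] xj]] gamma0.
move=> /lip_constP[Lg0 gL] /lip_constP[Lh0 hL] xr gxx'.
have /xr hxj : eps <= norm2 (g x - g (xs j)).
  rewrite -(lerD2r (e0 * lip_const g)) (le_trans gxx')//.
  rewrite (le_trans (norm2_dist_triangle _ (g (xs j)) _))// lerD2l norm2_distC.
  by rewrite (le_trans (gL _ _))// mulrC ler_wpM2r// ltW.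
(* A constant [h] cannot be [gamma]-far at two points, since [gamma > 0]. *)
have [Lh|Lh] := eqVneq (lip_const h) 0.
  have := le_trans hxj (hL x (xs j)).
  by rewrite Lh mul0r leNgt gamma0.
have {}Lh : 0 < lip_const h by rewrite lt_neqAle eq_sym Lh.
rewrite ltrBlDr (le_lt_trans hxj)//.
rewrite (le_lt_trans (norm2_dist_triangle _ (h x') _))// ltrD2l.
by rewrite (le_lt_trans (hL _ _))// mulrC ltr_pM2r.
Qed.

(** The objective of [set: M] dominates that of [S] term by term, because its
    weights have reached the cap 1; equal sums of nonnegative differences force
    equal terms, and a term determines its weight since the target distance is
    at least [eps > 0]. *)
Lemma resolved_sample (q : nat) (g : X -> 'rV[R]_q) (M : finType)
    (d : M -> nat) (ms : forall j : M, X -> 'rV[R]_(d j)) (gamma eps : R)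
    (m N : nat) (b : 'I_m -> X) (xs : 'I_N -> X) (S : {set M}) :
  0 < gamma -> 0 < eps ->
  (forall i, resolved g (concat ms [set: M]%SET) gamma eps xs (b i)) ->
  sampled_objective g ms gamma eps b xs S =
  sampled_objective g ms gamma eps b xs [set: M]%SET ->
  forall i, resolved g (concat ms S) gamma eps xs (b i).
Proof.
move=> gamma0 eps0 bM fSM i j gij.
have gamma20 : 0 < gamma ^+ 2 by rewrite exprn_gt0.
have wM i' j' : eps <= norm2 (g (b i') - g (xs j')) ->
    weight ms gamma (b i') (xs j') [set: M]%SET = 1.
  move=> /bM h; apply/min_idPr; rewrite ler_pdivlMl// mulr1.
  by rewrite lerXn2r ?nnegrE ?norm2_ge0 ?(ltW gamma0).
pose F S' i' j' :=
  weight ms gamma (b i') (xs j') S' * norm2 (g (b i') - g (xs j')) ^+ 2.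
have FS i' j' : eps <= norm2 (g (b i') - g (xs j')) ->
    F S i' j' <= F [set: M]%SET i' j'.
  move=> e; rewrite /F wM// ler_wpM2r ?sqr_ge0//.
  by rewrite /weight ge_min lexx orbT.
(* The normalization is nonzero as the indices [i] and [j] exist. *)
have mN : ((m * N)%:R : R)^-1 != 0.
  rewrite invr_eq0 pnatr_eq0 muln_eq0 negb_or -!lt0n.
  by rewrite (leq_trans _ (ltn_ord i))// (leq_trans _ (ltn_ord j)).
move/(mulfI mN): fSM => /eqP fSM.
pose T S' := \sum_(j' < N | eps <= norm2 (g (b i) - g (xs j'))) F S' i j'.
have Ti : T S = T [set: M]%SET.
  apply/eqP; move: fSM; rewrite eq_sym -subr_eq0 -sumrB psumr_eq0.
    by move=> /allP/(_ i (mem_index_enum _)) /=; rewrite subr_eq0 eq_sym.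
  by move=> i' _; rewrite subr_ge0; apply: ler_sum => j' /FS.
have Fij : F S i j = F [set: M]%SET i j.
  apply/eqP; move/eqP: Ti; rewrite eq_sym -subr_eq0 -sumrB psumr_eq0.
    move=> /allP/(_ j (mem_index_enum _)) /=.
    by rewrite gij subr_eq0 eq_sym.
  by move=> j' /FS; rewrite subr_ge0.
have : weight ms gamma (b i) (xs j) S = 1.
  rewrite -(wM _ _ gij); apply: mulIf Fij.
  by rewrite expf_neq0// gt_eqF// (lt_le_trans eps0).
rewrite /weight => /min_idPr; rewrite ler_pdivlMl// mulr1.
by rewrite ler_pXn2r// nnegrE ?norm2_ge0// ltW.
Qed.

End resolved.

(** * The sample size *)

(** The function [h t = exp (2 t ^ 2) (1 - t)] has derivative
    [- exp (2 t ^ 2) (2 t - 1) ^ 2 <= 0], so it stays below [h 0 = 1]. *)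
Lemma onem_le_expR_sqr (R : realType) (x : R) :
  0 <= x -> 1 - x <= expR (- (2 * x ^+ 2)).
Proof.
move=> x0.
pose h (t : R) := expR (2 * t ^+ 2) * (1 - t).
have dh (t : R) :
    is_derive t (1 : R) h (- (expR (2 * t ^+ 2) * (2 * t - 1) ^+ 2)).
  rewrite /h; apply: is_derive_eq.
  rewrite /GRing.scale/=; ring.
have : h x <= h 0.
  apply: (@ler0_derive1_nincry _ h 0) => //.
  - move=> t _; rewrite derive1E derive_val oppr_le0.
    by rewrite mulr_ge0 ?expR_ge0 ?sqr_ge0.
  - apply: derivable_within_continuous => t _; exact: ex_derive.
rewrite /h expr0n/= mulr0 expR0 subr0 mulr1 expRN => hx.
by rewrite -[leRHS]mulr1 ler_pdivlMl ?expR_gt0.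
Qed.

(** After bounding [1 - delta], the hypothesis on [m] is exactly the logarithm
    of the claim. *)
Lemma union_bound_le (R : realType) (m k : nat) (p delta : R) :
  0 < p -> 0 < delta -> delta < 1 ->
  (2 * delta ^+ 2)^-1 * (k%:R * ln 2 - ln p) <= m%:R ->
  (2 ^ k)%:R * (1 - delta) ^+ m <= p.
Proof.
move=> p0 d0 d1 hm.
have d20 : 0 < 2 * delta ^+ 2 by rewrite mulr_gt0// exprn_gt0.
apply: (@le_trans _ _ (expR (k%:R * ln 2) * expR (- (2 * delta ^+ 2)) ^+ m)).
  rewrite expRM_natl lnK ?posrE// natrX ler_wpM2l ?exprn_ge0//.
  by rewrite lerXn2r ?nnegrE ?subr_ge0 ?expR_ge0 ?onem_le_expR_sqr ?ltW.
rewrite -expRM_natr -expRD -[leRHS]lnK ?posrE// ler_expR.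
move: hm; rewrite ler_pdivrMl// lerBlDr mulNr lerBlDr.
by rewrite addrC [X in _ <= X]addrC.
Qed.

(** * The union bound over an independent sample *)

Section sampling.
Context (R : realType) (dO dT : measure_display) (Omega : measurableType dO)
  (T : measurableType dT) (P : probability Omega R) (mu : probability T R)
  (m : nat) (b : 'I_m -> {RV P >-> T}).

Lemma prob_sample_in (G : set T) : iid_sample mu b -> measurable G ->
  P (\bigcap_(i in [set: 'I_m]) (b i @^-1` G)) = ((fine (mu G)) ^+ m)%:E.
Proof.
move=> [law indep] mG.
have := indep [set: 'I_m]%SET (fun=> G) (fun _ _ => mG).
rewrite (_ : [set i | i \in _] = setT); last first.
  by apply/seteqP; split => i //= _; rewrite inE.
move=> ->; rewrite (eq_bigr (fun=> (fine (mu G))%:E)); last first.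
  by move=> i _; rewrite fineK ?fin_num_measure//; exact: law.
by rewrite prodEFin prodr_const cardsT card_ord.
Qed.

(** A sample is unlikely to fall entirely inside a member of a finite family
    that has small measure; the bound is uniform over the family, so that the
    member may be chosen after seeing the sample. *)
Lemma prob_covering_sets_large (I : finType) (G : I -> set T) (p delta : R) :
  iid_sample mu b -> (forall k, measurable (G k)) -> delta <= 1 ->
  #|I|%:R * (1 - delta) ^+ m <= p ->
  measure_at_least P
    [set w | forall k, (forall i, G k (b i w)) ->
                       ((1 - delta)%:E <= mu (G k))%E]
    (1 - p).
Proof.
move=> hb mG d1 hp.
pose small := [seq k <- index_enum I | (mu (G k) < (1 - delta)%:E)%E].
pose F k := \bigcap_(i in [set: 'I_m]) (b i @^-1` G k).
have mF k : measurable (F k).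
  by apply: fin_bigcap_measurable => // i _; exact: measurable_funPTI.
have mB : measurable (\bigcup_(k in [set` small]) F k).
  by apply: fin_bigcup_measurable => //; exact: finite_seq.
exists (~` (\bigcup_(k in [set` small]) F k)); split; first exact: measurableC.
  move=> w /= Bw k Gk; rewrite leNgt; apply/negP => smallk.
  apply: Bw; exists k => [|i _]; last exact: Gk.
  by rewrite /= mem_filter smallk mem_index_enum.
rewrite probability_setC// EFinB leeB//.
have := content_sub_fsum P (finite_seq small) (fun k _ => mF k) mB (fun=> id).
move=> /le_trans; apply.
rewrite -fsbig_seq ?filter_uniq ?index_enum_uniq// big_filter.
pose c := (1 - delta) ^+ m.
apply: (@le_trans _ _ (\sum_(k | (mu (G k) < (1 - delta)%:E)%E) c%:E)%E).
  apply: lee_sum => k smallk; rewrite [leLHS](prob_sample_in hb (mG k)) lee_fin.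
  have mu1 : fine (mu (G k)) < 1 - delta.
    by rewrite -lte_fin fineK ?fin_num_measure.
  by rewrite lerXn2r ?nnegrE ?fine_ge0// ?ltW// (le_lt_trans _ mu1) ?fine_ge0.
rewrite sumEFin lee_fin sumr_const (le_trans _ hp)// -(mulr_natl c).
by rewrite ler_wpM2r ?exprn_ge0 ?subr_ge0// ler_nat max_card.
Qed.

End sampling.

Theorem theorem5p4 (R : realType) (n : nat) (X : set 'rV[R]_n)
    (X0 : X !=set0)
    (M : finType) (q : nat) (g : X -> 'rV[R]_q)
    (d : M -> nat) (ms : forall j : M, X -> 'rV[R]_(d j))
    (e0 : R) (N : nat) (xs : 'I_N -> X) (hnet : is_net e0 (range xs))
    (mu : probability (borel X0) R)
    (dO : measure_display) (Omega : measurableType dO)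
    (P : probability Omega R)
    (m : nat) (b : 'I_m -> {RV P >-> borel X0}) (hb : iid_sample mu b)
    (p delta : R) (hp : 0 < p < 1) (hdelta : 0 < delta < 1)
    (hm : (2 * delta ^+ 2)^-1 * (#|M|%:R * ln 2 - ln p) <= m%:R)
    (gamma eps : R) (hgamma : 0 < gamma) (heps : 0 < eps)
    (hg : is_lipschitz g) (hms : forall j : M, is_lipschitz (ms j)) :
  measure_at_least P
    [set w : Omega |
      (forall (i : 'I_m) (j : 'I_N),
         eps <= norm2 (g (b i w) - g (xs j)) ->
         gamma <= norm2 (concat ms [set: M]%SET (b i w)
                         - concat ms [set: M]%SET (xs j))) ->
      forall S : {set M},
        sampled_objective g ms gamma eps (fun i => b i w) xs S =
        sampled_objective g ms gamma eps (fun i => b i w) xs [set: M]%SET ->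
        measure_at_least mu
          [set x : borel X0 | forall x' : X,
             eps + e0 * lip_const g <= norm2 (g x - g x') ->
             gamma - e0 * lip_const (concat ms S)
               < norm2 (concat ms S x - concat ms S x')]
          (1 - delta)]
    (1 - p).
Proof.
have [p0 p1] := andP hp; have [d0 d1] := andP hdelta.
have cl S : is_lipschitz (concat ms S) by exact: lipschitz_concat.
pose G S : set (borel X0) := resolved g (concat ms S) gamma eps xs.
have mG S : measurable (G S) by exact: measurable_resolved.
have small : #|{set M}|%:R * (1 - delta) ^+ m <= p.
  by rewrite -cardsT -powersetT card_powerset cardsT union_bound_le.
have [A [mA AG PA]] := prob_covering_sets_large hb mG (ltW d1) small.
exists A; split => // w /AG /= large bM S fS; exists (G S); split => //.
  move=> x xG x' gxx.
  exact: (resolved_separates hnet hgamma hg (cl S) xG gxx).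
by apply: large; exact: resolved_sample bM fS.
Qed.
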